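(* Let $D_0\in A_0=\mathcal U(\mathfrak g_0)\otimes_{\mathbb C}\operatorname{Cl}(\mathfrak p_0,\beta_0)$ be the algebraic Dirac operator of the Cartan motion group $G(\mathbb R)_0$, and let $\Omega_0=\Omega(\mathfrak p_0,\beta_0)\in\mathcal U(\mathfrak g_0)$ be its Casimir element. Then in $A_0$, $$2D_0^2=\Omega(\mathfrak p_0,\beta_0)\otimes 1_{\operatorname{Cl}(\mathfrak p_0,\beta_0)}.$$
   Context: Setting. $G$ is a connected complex reductive algebraic group with an antiholomorphic involution $\sigma$ such that $G(\mathbb R):=G^\sigma$ is connected and noncompact; $\theta$ is a corresponding Cartan involution of $G$ (commuting with $\sigma$); $K:=G^\theta$ and $K(\mathbb R):=K^\sigma$ is a maximal compact subgroup of $G(\mathbb R)$. Put $\mathfrak g=\mathrm{Lie}(G)$, $\mathfrak k=\mathrm{Lie}(K)$, and let $\mathfrak p$ be the $(-1)$-eigenspace of $\theta$ on $\mathfrak g$; then $\mathfrak g=\mathfrak k\oplus\mathfrak p$, with real forms $\mathfrak g^\sigma=\mathfrak k^\sigma\oplus\mathfrak p^\sigma$. The Cartan motion group is $G(\mathbb R)_0=\mathfrak p^\sigma\rtimes K(\mathbb R)$. Its complexified Lie algebra is $\mathfrak g_0=\mathfrak k\oplus\mathfrak p_0$ with $\mathfrak p_0=\mathfrak p$ as a $K$-module and bracket $[X_1+Y_1,X_2+Y_2]_0=[Y_1,X_2]+[X_1,Y_2]+[Y_1,Y_2]$ for $X_i\in\mathfrak p$, $Y_i\in\mathfrak k$ (so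 $\mathfrak p_0$ is an abelian ideal). Form. Fix a symmetric bilinear form $\beta$ on $\mathfrak g$ which restricts to the Killing form on $[\mathfrak g,\mathfrak g]$, is positive definite on $\mathfrak p^\sigma$ and negative definite on $\mathfrak k^\sigma$, and is $\theta$-, $K$- and $\mathfrak g$-invariant. Put $\beta_0=\beta|_{\mathfrak p_0\times\mathfrak p_0}$, which is nondegenerate. Clifford algebra. $\operatorname{Cl}(\mathfrak p_0,\beta_0)$ is the quotient of the tensor algebra $T(\mathfrak p_0)$ by the two-sided ideal generated by $X\otimes Y+Y\otimes X-\beta_0(X,Y)$, $X,Y\in\mathfrak p_0$; $\gamma_0:\mathfrak p_0\to\operatorname{Cl}(\mathfrak p_0,\beta_0)$ is the canonical embedding. Canonical elements. Let $\omega(\mathfrak p_0,\beta_0)\in\mathfrak p_0\otimes_{\mathbb C}\mathfrak p_0$ be the image of $\operatorname{Id}_{\mathfrak p_0}$ under $\operatorname{End}(\mathfrak p_0)\cong\mathfrak p_0^*\otimes\mathfrak p_0\cong\mathfrak p_0\otimes\mathfrak p_0$, the last map using $\beta_0$ to identify $\mathfrak p_0^*\cong\mathfrak p_0$; for a basis $\{e_i\}$ with $\beta_0$-dual basis $\{e'_i\}$, $\omega(\mathfrak p_0,\beta_0)=\sum_i e_i'\otimes e_i=\sum_i e_i\otimes e_i'$. The Casimir element $\Omega_0=\Omega(\mathfrak p_0,\beta_0)$ is the image of $\omega(\mathfrak p_0,\beta_0)$ in $\mathcal U(\mathfrak g_0)$ under multiplication, $\Omega_0=\sum_i e'_ie_i$.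 The Dirac operator is the image of $\omega(\mathfrak p_0,\beta_0)$ in $A_0$ under $X\otimes Y\mapsto X\otimes\gamma_0(Y)$, i.e. $D_0=\sum_i e_i\otimes\gamma_0(e'_i)$. *)

(* Defs.v *)
From HB Require Import structures.
From mathcomp Require Import all_boot all_order all_algebra.
From mathcomp Require Import finmap.
From mathcomp Require Import complex monalg.
From mathcomp Require Import all_classical all_reals all_analysis.

Set Implicit Arguments.
Unset Strict Implicit.
Unset Printing Implicit Defensive.

Import Order.TTheory GRing.Theory Num.Theory.
Import numFieldNormedType.Exports.

Local Open Scope classical_set_scope.
Local Open Scope ring_scope.

Section Submodule.
Variables (F : fieldType) (V : lmodType F) (S : set V).

Definition is_submodule (W : set V) : Prop :=
  W 0 /\ forall (a : F) (x y : V), W x -> W y -> W (a *: x + y).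

Definition gen_submodule : set V :=
  [set x | forall W : set V, is_submodule W -> S `<=` W -> W x].

Definition gen_submodule_pred : V -> bool := fun x => `[< gen_submodule x >].

Lemma gen_submodule_zmod_closed : zmod_closed gen_submodule_pred.
Proof.
split=> [|x y /asboolP hx /asboolP hy]; apply/asboolP => W hW SW.
  by case: hW.
have [W0 WP] := hW; rewrite -[x - y]addrC -scaleN1r.
by apply: WP; [exact: hy|exact: hx].
Qed.

HB.instance Definition _ :=
  GRing.isZmodClosed.Build V gen_submodule_pred gen_submodule_zmod_closed.

Lemma gen_submoduleZ (a : F) x : gen_submodule x -> gen_submodule (a *: x).
Proof.
move=> hx W hW SW; have [W0 WP] := hW.
by rewrite -[_ *: _]addr0; apply: WP => //; exact: hx.
Qed.

End Submodule.

Section QuotientModule.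
Variables (F : fieldType) (V : lmodType F) (S : set V).

Local Notation quotV :=
  (Quotient.quot (GRing.ZmodClosed.clone V (gen_submodule_pred S) _)).

Definition quot_module : Type := quotV.
HB.instance Definition _ := GRing.Zmodule.on quot_module.

(* [locked] here and below only prevents costly unfolding by unification. *)
Definition qm_pi : V -> quot_module := locked (fun x => (\pi_(quotV) x)%qT).
Definition qm_repr (x : quot_module) : V :=
  repr (x : quotV).

Lemma qm_reprK x : qm_pi (qm_repr x) = x.
Proof. by rewrite /qm_pi -lock; exact: reprK. Qed.

Lemma qm_piP x y : (qm_pi x = qm_pi y) <-> gen_submodule S (x - y).
Proof.
rewrite /qm_pi -lock; split=> [/eqP|h].
  by rewrite -Quotient.idealrBE => /asboolP.
by apply/eqP; rewrite -Quotient.idealrBE; apply/asboolP.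
Qed.

Lemma qm_piD x y : qm_pi (x + y) = qm_pi x + qm_pi y.
Proof. by rewrite /qm_pi -lock; exact: (raddfD (\pi_(quotV))%qT). Qed.

Definition qm_scale (a : F) (x : quot_module) : quot_module :=
  qm_pi (a *: qm_repr x).

Lemma qm_scale_pi a x : qm_scale a (qm_pi x) = qm_pi (a *: x).
Proof.
apply/qm_piP; rewrite -scalerBr; apply: gen_submoduleZ.
by apply/qm_piP; rewrite qm_reprK.
Qed.

Fact qm_scalerA a b v : qm_scale a (qm_scale b v) = qm_scale (a * b) v.
Proof. by rewrite -[v]qm_reprK !qm_scale_pi scalerA. Qed.

Fact qm_scale1r : left_id 1 qm_scale.
Proof. by move=> v; rewrite -[v]qm_reprK qm_scale_pi scale1r. Qed.

Fact qm_scalerDr : right_distributive qm_scale +%R.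
Proof.
move=> a u v; rewrite -[u]qm_reprK -[v]qm_reprK.
by rewrite -qm_piD !qm_scale_pi scalerDr qm_piD.
Qed.

Fact qm_scalerDl v : {morph qm_scale^~ v : a b / a + b}.
Proof.
by move=> a b; rewrite -[v]qm_reprK !qm_scale_pi scalerDl qm_piD.
Qed.

HB.instance Definition _ := GRing.Zmodule_isLmodule.Build F quot_module
  qm_scalerA qm_scale1r qm_scalerDr qm_scalerDl.

Fact qm_pi_linear : linear qm_pi.
Proof. by move=> a x y; rewrite qm_piD -qm_scale_pi. Qed.

HB.instance Definition _ :=
  GRing.isLinear.Build F V quot_module *:%R qm_pi qm_pi_linear.

End QuotientModule.

Section QuotientAlgebra.
Variables (F : fieldType) (A : algType F) (S : set A).

(* Its linear span is the two-sided ideal generated by S. *)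
Definition two_sided_multiples : set A :=
  [set x | exists a s b, S s /\ x = a * s * b].

Local Notation ideal := (gen_submodule two_sided_multiples).

Lemma ideal_mull a x : ideal x -> ideal (a * x).
Proof.
move=> hx; apply: (hx [set y | ideal (a * y)]).
  split=> [|c u v hu hv] W hW SW; have [W0 WP] := hW.
    by rewrite mulr0.
  by rewrite mulrDr -scalerAr; apply: WP; [exact: hu|exact: hv].
move=> _ [c [s [b [Ss ->]]]] W hW; apply.
by exists (a * c), s, b; rewrite !mulrA.
Qed.

Lemma ideal_mulr a x : ideal x -> ideal (x * a).
Proof.
move=> hx; apply: (hx [set y | ideal (y * a)]).
  split=> [|c u v hu hv] W hW SW; have [W0 WP] := hW.
    by rewrite mul0r.
  by rewrite mulrDl -scalerAl; apply: WP; [exact: hu|exact: hv].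
move=> _ [c [s [b [Ss ->]]]] W hW; apply.
by exists c, s, (b * a); rewrite !mulrA.
Qed.

Definition quot_alg : Type := quot_module two_sided_multiples.
HB.instance Definition _ := GRing.Lmodule.on quot_alg.

Definition qa_pi : A -> quot_alg := @qm_pi F A two_sided_multiples.
HB.instance Definition _ := GRing.Linear.copy qa_pi
  (@qm_pi F A two_sided_multiples).

Definition qa_repr : quot_alg -> A := @qm_repr F A two_sided_multiples.

Lemma qa_reprK x : qa_pi (qa_repr x) = x.
Proof. exact: qm_reprK. Qed.

Definition qa_mul : quot_alg -> quot_alg -> quot_alg :=
  locked (fun x y => qa_pi (qa_repr x * qa_repr y)).

Lemma qa_mul_pi x y : qa_mul (qa_pi x) (qa_pi y) = qa_pi (x * y).
Proof.
rewrite /qa_mul -lock.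
transitivity (qa_pi (qa_repr (qa_pi x) * y)); apply/qm_piP.
  rewrite -mulrBr; apply: ideal_mull; apply/qm_piP; exact: qm_reprK.
rewrite -mulrBl; apply: ideal_mulr; apply/qm_piP; exact: qm_reprK.
Qed.

Fact qa_mulA : associative qa_mul.
Proof.
move=> x y z; rewrite -[x]qa_reprK -[y]qa_reprK -[z]qa_reprK.
by rewrite !qa_mul_pi mulrA.
Qed.

Fact qa_mul1 : left_id (qa_pi 1) qa_mul.
Proof. by move=> x; rewrite -[x]qa_reprK qa_mul_pi mul1r. Qed.

Fact qa_mulr1 : right_id (qa_pi 1) qa_mul.
Proof. by move=> x; rewrite -[x]qa_reprK qa_mul_pi mulr1. Qed.

Fact qa_mulDl : left_distributive qa_mul +%R.
Proof.
move=> x y z; rewrite -[x]qa_reprK -[y]qa_reprK -[z]qa_reprK.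
by rewrite -raddfD !qa_mul_pi mulrDl raddfD.
Qed.

Fact qa_mulDr : right_distributive qa_mul +%R.
Proof.
move=> x y z; rewrite -[x]qa_reprK -[y]qa_reprK -[z]qa_reprK.
by rewrite -raddfD !qa_mul_pi mulrDr raddfD.
Qed.

HB.instance Definition _ := GRing.Zmodule_isPzRing.Build quot_alg
  qa_mulA qa_mul1 qa_mulr1 qa_mulDl qa_mulDr.

Lemma qa_piM x y : qa_pi (x * y) = qa_pi x * qa_pi y.
Proof. by rewrite -qa_mul_pi. Qed.

Lemma qa_pi1 : qa_pi 1 = 1.
Proof. by []. Qed.

Lemma qa_piZ (a : F) x : qa_pi (a *: x) = a *: qa_pi x.
Proof. by rewrite [RHS]qm_scale_pi. Qed.

Lemma qa_scalerAl (a : F) (x y : quot_alg) : a *: (x * y) = (a *: x) * y.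
Proof.
by rewrite -[x]qa_reprK -[y]qa_reprK -qa_piZ -!qa_piM -qa_piZ scalerAl.
Qed.

Lemma qa_scalerAr (a : F) (x y : quot_alg) : a *: (x * y) = x * (a *: y).
Proof.
by rewrite -[x]qa_reprK -[y]qa_reprK -qa_piZ -!qa_piM -qa_piZ scalerAr.
Qed.

End QuotientAlgebra.

Lemma malg_scalerAr (F : fieldType) (K : monomType) (c : F)
  (x y : {malg F[K]}) : c *: (x * y) = x * (c *: y).
Proof.
apply/malgP => k; rewrite mcoeffZ (mcoeffMlw k (finmap.fsubset_refl _) (msuppZ_le c y)).
rewrite mcoeffMl big_distrr /=; apply: eq_bigr => k1 _.
rewrite big_distrr /=; apply: eq_bigr => k2 _.
by rewrite mcoeffZ mulrCA mulrnAr.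
Qed.

Section TensorAlgebra.
Variables (F : fieldType) (V : lmodType F).

Definition free_alg : Type := {malg F[{fmonom V}]}.
HB.instance Definition _ := GRing.Lalgebra.on free_alg.

Fact free_alg_scalerAr (c : F) (x y : free_alg) : c *: (x * y) = x * (c *: y).
Proof.
exact: malg_scalerAr.
Qed.
HB.instance Definition _ :=
  GRing.Lalgebra_isAlgebra.Build F free_alg free_alg_scalerAr.

Definition free_gen (v : V) : free_alg := mkmalgU (fmu v) 1.

Definition linear_relations : set free_alg :=
  [set x | exists (a : F) (u v : V),
     x = free_gen (a *: u + v) - (a *: free_gen u + free_gen v)].

Definition tensor_alg : Type := quot_alg linear_relations.
HB.instance Definition _ := GRing.Lmodule.on tensor_alg.
HB.instance Definition _ := GRing.PzRing.on tensor_alg.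

Fact tensor_alg_1_neq0 : (1 : tensor_alg) != 0.
Proof.
pose cst (x : {malg F[{fmonom V}]}) := mcoeff (@fmone V) x.
have cst_lin (c : F) x y : cst (c *: x + y) = c * cst x + cst y.
  by rewrite /cst mcoeffD mcoeffZ.
have cstM x y : cst (x * y) = cst x * cst y by rewrite /cst rmorphM.
have cst_gen w : cst (free_gen w) = 0.
  by rewrite /cst /free_gen mcoeffU -val_eqE /= fmuE fm1.
have ideal0 x : gen_submodule (two_sided_multiples linear_relations) x ->
    cst x = 0.
  move=> /(_ [set y | cst y = 0]); apply.
    split=> [|c u v /= hu hv]; first exact: mcoeff0.
    by rewrite cst_lin hu hv mulr0 addr0.
  move=> _ [a [_ [b [[c [u [v ->]]] ->]]]] /=; rewrite !cstM.
  have -> : cst (free_gen (c *: u + v) - (c *: free_gen u + free_gen v)) = 0.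
    rewrite addrC -scaleN1r cst_lin cst_lin !cst_gen.
    by rewrite mulr0 !addr0 mulr0.
  by rewrite mulr0 mul0r.
apply/eqP => h; have /qm_piP : qm_pi (two_sided_multiples linear_relations) 1 =
    qm_pi (two_sided_multiples linear_relations) 0 by rewrite raddf0.
by rewrite subr0 => /ideal0 /eqP; rewrite /cst mcoeff1 eqxx oner_eq0.
Qed.
HB.instance Definition _ :=
  GRing.PzSemiRing_isNonZero.Build tensor_alg tensor_alg_1_neq0.
HB.instance Definition _ := GRing.Lmodule_isLalgebra.Build F tensor_alg
  (@qa_scalerAl F free_alg linear_relations).
HB.instance Definition _ := GRing.Lalgebra_isAlgebra.Build F tensor_alg
  (@qa_scalerAr F free_alg linear_relations).

Definition tensor_emb : V -> tensor_alg :=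
  locked (fun v => qa_pi linear_relations (free_gen v)).

End TensorAlgebra.

Section TensorModule.
Variables (F : fieldType) (V W : lmodType F).

Definition free_mod : lmodType F := {malg F[(V * W)%type]}.

Definition free_pair (v : V) (w : W) : free_mod := mkmalgU (v, w) 1.

Definition bilinear_relations : set free_mod :=
  [set x | (exists (a : F) (u v : V) (w : W),
              x = free_pair (a *: u + v) w -
                  (a *: free_pair u w + free_pair v w)) \/
           (exists (a : F) (v : V) (u w : W),
              x = free_pair v (a *: u + w) -
                  (a *: free_pair v u + free_pair v w))].

Definition tens_mod : Type := quot_module bilinear_relations.
HB.instance Definition _ := GRing.Lmodule.on tens_mod.

Definition tens : V -> W -> tens_mod :=
  locked (fun v w => qm_pi bilinear_relations (free_pair v w)).

Lemma tensE v w : tens v w = qm_pi bilinear_relations (free_pair v w).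
Proof. by rewrite /tens -lock. Qed.

Definition free_lift (M : lmodType F) (f : V -> W -> M) (x : free_mod) : M :=
  \sum_(k <- msupp x) mcoeff k x *: f k.1 k.2.

(* The linear map V (x) W -> M induced by a bilinear map f. *)
Definition tens_lift (M : lmodType F) (f : V -> W -> M) : tens_mod -> M :=
  locked (fun x => free_lift f (qm_repr x)).

Lemma free_lift_sub (M : lmodType F) (f : V -> W -> M) d (x : free_mod) :
  finmap.fsubset (msupp x) d ->
  free_lift f x = \sum_(k <- d) mcoeff k x *: f k.1 k.2.
Proof.
move=> xd; apply: finmap.big_fset_incl => // k _ kx.
by rewrite mcoeff_outdom ?scale0r.
Qed.

Lemma free_lift_linear (M : lmodType F) (f : V -> W -> M) : linear (free_lift f).
Proof.
move=> a x y.
pose d := finmap.fsetU (msupp x) (msupp y).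
have hx : finmap.fsubset (msupp x) d by exact: finmap.fsubsetUl.
have hy : finmap.fsubset (msupp y) d by exact: finmap.fsubsetUr.
have hxy : finmap.fsubset (msupp (a *: x + y)) d.
  apply: finmap.fsubset_trans (msuppD_le _ _) _.
  by rewrite finmap.fsetSU // msuppZ_le.
rewrite (free_lift_sub f hx) (free_lift_sub f hy) (free_lift_sub f hxy).
rewrite scaler_sumr -big_split /=; apply: eq_bigr => k _.
by rewrite mcoeffD mcoeffZ scalerDl scalerA.
Qed.

HB.instance Definition _ (M : lmodType F) (f : V -> W -> M) :=
  GRing.isLinear.Build F free_mod M *:%R (free_lift f) (free_lift_linear f).

Lemma free_lift_pair (M : lmodType F) (f : V -> W -> M) v w :
  free_lift f (free_pair v w) = f v w.
Proof.
rewrite (@free_lift_sub _ _ (finmap.fset1 (v, w)) _ msuppU_le).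
by rewrite finmap.big_seq_fset1 mcoeffUU scale1r.
Qed.

Definition is_bilinear (M : lmodType F) (f : V -> W -> M) : Prop :=
  (forall w, linear (f^~ w)) /\ (forall v, linear (f v)).

Lemma tens_bilinear : is_bilinear tens.
Proof.
split=> [w a u v|v a u w]; rewrite !tensE -linearP; apply/qm_piP => X _; apply.
  by left; exists a, u, v, w.
by right; exists a, v, u, w.
Qed.

Section LiftTheory.
Variables (M : lmodType F) (f : V -> W -> M).
Hypothesis f_bilinear : is_bilinear f.

Lemma tens_lift_pi x : tens_lift f (qm_pi bilinear_relations x) = free_lift f x.
Proof.
have /qm_piP h := qm_reprK (qm_pi bilinear_relations x).
apply/eqP; rewrite -subr_eq0 /tens_lift -lock -linearB.
apply/eqP; apply: (h [set y | free_lift f y = 0]).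
  split=> [|a y z /= hy hz]; first exact: linear0.
  by rewrite free_lift_linear hy hz scaler0 addr0.
have [fl fr] := f_bilinear.
by move=> _ [[a [u [v [w ->]]]]|[a [v [u [w ->]]]]] /=;
  rewrite linearB /= free_lift_linear !free_lift_pair ?fl ?fr subrr.
Qed.

Lemma tens_liftE v w : tens_lift f (tens v w) = f v w.
Proof. by rewrite tensE tens_lift_pi free_lift_pair. Qed.

Lemma tens_lift_linear : linear (tens_lift f).
Proof.
move=> a x y; rewrite -[x]qm_reprK -[y]qm_reprK.
rewrite -[X in tens_lift f X]linearP; by rewrite  !tens_lift_pi free_lift_linear.
Qed.

End LiftTheory.

Lemma tens_ind (P : set tens_mod) :
  is_submodule P -> (forall v w, P (tens v w)) -> forall x, P x.
Proof.
move=> [P0 PP] Pvw x; rewrite -[x]qm_reprK (monalgE (qm_repr x)) raddf_sum.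
apply: (big_ind P) => [//|y z Py Pz|k _].
  by rewrite -[y]scale1r; apply: PP.
have -> : mkmalgU k (mcoeff k (qm_repr x)) =
    mcoeff k (qm_repr x) *: free_pair k.1 k.2.
  apply/malgP => l; rewrite /free_pair -surjective_pairing mcoeffZ !mcoeffU.
  by rewrite mulrnAr mulr1.
rewrite /= linearZ /=.
have := PP (mcoeff k (qm_repr x)) _ 0 (Pvw k.1 k.2) P0.
by rewrite addr0 tensE.
Qed.

End TensorModule.

Section LinearMaps.
Variables (F : fieldType) (V W : lmodType F).

Lemma linear_map0 (f : V -> W) : linear f -> f 0 = 0.
Proof.
by move=> h; apply: (addrI (f 0)); have := h 1 0 0; rewrite !scale1r !addr0.
Qed.

Lemma linear_comb (k : F) (f g : V -> W) :
  linear f -> linear g -> linear (fun x => k *: f x + g x).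
Proof.
move=> hf hg a x y; rewrite hf hg !scalerDr !scalerA [a * k]mulrC.
by rewrite addrACA.
Qed.

Lemma eq_is_submodule (f g : V -> W) :
  linear f -> linear g -> is_submodule [set x | f x = g x].
Proof.
move=> hf hg; split=> [|a x y /= fx fy].
  by rewrite /= !linear_map0.
by rewrite hf hg fx fy.
Qed.

End LinearMaps.

Lemma linear_comp (F : fieldType) (U V W : lmodType F) (f : V -> W)
  (g : U -> V) : linear f -> linear g -> linear (f \o g).
Proof. by move=> hf hg a x y; rewrite /= hg hf. Qed.

Lemma tens_ext (F : fieldType) (V W M : lmodType F) (f g : tens_mod V W -> M) :
  linear f -> linear g -> (forall v w, f (tens v w) = g (tens v w)) ->
  f =1 g.
Proof.
by move=> hf hg h x; apply: (tens_ind (eq_is_submodule hf hg) h x).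
Qed.

Section TensorProductOfAlgebras.
Variables (F : fieldType) (A B : algType F) (S : set A) (T : set B).
Local Notation A' := (quot_alg S).
Local Notation B' := (quot_alg T).

Definition tens_prod : Type := tens_mod A' B'.
HB.instance Definition _ := GRing.Lmodule.on tens_prod.

Definition pure_tens (a : A') (b : B') : tens_prod := tens a b.

Definition tens_mul_pure (a : A') (b : B') (y : tens_prod) : tens_prod :=
  tens_lift (fun c d => pure_tens (a * c) (b * d)) y.

(* (a (x) b) (c (x) d) = ac (x) bd, extended bilinearly *)
Definition tens_mul : tens_prod -> tens_prod -> tens_prod :=
  locked (fun x y => tens_lift (fun a b => tens_mul_pure a b y) x).

Lemma pure_tensDl a a' b : pure_tens (a + a') b = pure_tens a b + pure_tens a' b.
Proof.
by have := (@tens_bilinear _ A' B').1 b 1 a a'; rewrite /= !scale1r.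
Qed.

Lemma pure_tensDr a b b' : pure_tens a (b + b') = pure_tens a b + pure_tens a b'.
Proof.
by have := (@tens_bilinear _ A' B').2 a 1 b b'; rewrite /= !scale1r.
Qed.

Lemma pure_tensZl (k : F) a b : pure_tens (k *: a) b = k *: pure_tens a b.
Proof.
have h := (@tens_bilinear _ A' B').1 b.
have h0 : pure_tens 0 b = 0.
  by apply: (addrI (pure_tens 0 b)); rewrite -pure_tensDl !addr0.
by have := h k a 0; rewrite /= addr0 -/(pure_tens _ _) -/(pure_tens 0 b) h0 addr0.
Qed.

Lemma pure_tensZr (k : F) a b : pure_tens a (k *: b) = k *: pure_tens a b.
Proof.
have h := (@tens_bilinear _ A' B').2 a.
have h0 : pure_tens a 0 = 0.
  by apply: (addrI (pure_tens a 0)); rewrite -pure_tensDr !addr0.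
by have := h k b 0; rewrite /= addr0 -/(pure_tens _ _) -/(pure_tens a 0) h0 addr0.
Qed.

Lemma tens_mul_pure_bilinear (a : A') (b : B') :
  is_bilinear (fun (c : A') (d : B') => pure_tens (a * c) (b * d) : tens_prod).
Proof.
split=> [d k c c'|c k d d'] /=.
  by rewrite mulrDr -qa_scalerAr pure_tensDl pure_tensZl.
by rewrite mulrDr -qa_scalerAr pure_tensDr pure_tensZr.
Qed.

Lemma tens_mul_pure_linear (a : A') (b : B') : linear (tens_mul_pure a b).
Proof. exact: (tens_lift_linear (tens_mul_pure_bilinear a b)). Qed.

Lemma tens_mul_pureE (a : A') (b : B') (c : A') (d : B') :
  tens_mul_pure a b (pure_tens c d) = pure_tens (a * c) (b * d).
Proof. exact: (tens_liftE (tens_mul_pure_bilinear a b)). Qed.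

Lemma tens_mul_bilinear (y : tens_prod) :
  is_bilinear (fun (a : A') (b : B') => tens_mul_pure a b y).
Proof.
split=> [b k a a'|a k b b'].
  apply: (tens_ext (tens_mul_pure_linear (k *: a + a') b)
    (linear_comb k (tens_mul_pure_linear a b) (tens_mul_pure_linear a' b)) _ y).
  move=> c d; rewrite /= -[tens c d]/(pure_tens c d) !tens_mul_pureE.
  by rewrite mulrDl -qa_scalerAl pure_tensDl pure_tensZl.
apply: (tens_ext (tens_mul_pure_linear a (k *: b + b'))
  (linear_comb k (tens_mul_pure_linear a b) (tens_mul_pure_linear a b')) _ y).
move=> c d; rewrite /= -[tens c d]/(pure_tens c d) !tens_mul_pureE.
by rewrite mulrDl -qa_scalerAl pure_tensDr pure_tensZr.
Qed.

Lemma tens_mul_linl (z : tens_prod) : linear (tens_mul^~ z).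
Proof.
by rewrite /tens_mul -lock; exact: (tens_lift_linear (tens_mul_bilinear z)).
Qed.

Lemma tens_mul_pureL (a : A') (b : B') y :
  tens_mul (pure_tens a b) y = tens_mul_pure a b y.
Proof.
by rewrite /tens_mul -lock; exact: (tens_liftE (tens_mul_bilinear y)).
Qed.

Lemma tens_mul_linr (x : tens_prod) : linear (tens_mul x).
Proof.
move=> k y z.
apply: (tens_ext (tens_mul_linl (k *: y + z))
  (linear_comb k (tens_mul_linl y) (tens_mul_linl z)) _ x) => a b.
rewrite /= -[tens a b]/(pure_tens a b) !tens_mul_pureL.
exact: tens_mul_pure_linear.
Qed.

Lemma tens_mulE (a : A') (b : B') (c : A') (d : B') :
  tens_mul (pure_tens a b) (pure_tens c d) = pure_tens (a * c) (b * d).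
Proof. by rewrite tens_mul_pureL tens_mul_pureE. Qed.

Fact tens_mulDl : left_distributive tens_mul +%R.
Proof.
by move=> x y z; have := tens_mul_linl z 1 x y; rewrite /= !scale1r.
Qed.

Fact tens_mulDr : right_distributive tens_mul +%R.
Proof.
by move=> x y z; have := tens_mul_linr x 1 y z; rewrite /= !scale1r.
Qed.

Fact tens_mulA : associative tens_mul.
Proof.
move=> x y z; apply: (tens_ext (tens_mul_linl (tens_mul y z))
  (linear_comp (tens_mul_linl z) (tens_mul_linl y)) _ x) => a b /=.
apply: (tens_ext (linear_comp (tens_mul_linr (tens a b)) (tens_mul_linl z))
  (linear_comp (tens_mul_linl z) (tens_mul_linr (tens a b))) _ y) => c d /=.
apply: (tens_ext (linear_comp (tens_mul_linr (tens a b))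
  (tens_mul_linr (tens c d))) (tens_mul_linr _) _ z) => e f /=.
rewrite -[tens a b]/(pure_tens a b) -[tens c d]/(pure_tens c d) -[tens e f]/(pure_tens e f).
by rewrite 4!tens_mulE (mulrA a) (mulrA b).
Qed.

Lemma linear_idfun : linear (@idfun tens_prod).
Proof. by []. Qed.

Fact tens_mul1 : left_id (pure_tens 1 1) tens_mul.
Proof.
move=> x; apply: (tens_ext (tens_mul_linr (pure_tens 1 1)) linear_idfun _ x) => a b.
by rewrite -[tens a b]/(pure_tens a b) tens_mulE (mul1r a) (mul1r b).
Qed.

Fact tens_mulr1 : right_id (pure_tens 1 1) tens_mul.
Proof.
move=> x; apply: (tens_ext (tens_mul_linl (pure_tens 1 1)) linear_idfun _ x) => a b.
by rewrite -[tens a b]/(pure_tens a b) tens_mulE (mulr1 a) (mulr1 b).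
Qed.

HB.instance Definition _ := GRing.Zmodule_isPzRing.Build tens_prod
  tens_mulA tens_mul1 tens_mulr1 tens_mulDl tens_mulDr.

End TensorProductOfAlgebras.

Section AlgebrasOfAForm.
Variables (F : fieldType) (V : lmodType F).

Definition lie_relations (br : V -> V -> V) : set (tensor_alg V) :=
  [set x | exists X Y : V,
     x = tensor_emb X * tensor_emb Y - tensor_emb Y * tensor_emb X
         - tensor_emb (br X Y)].

Definition enveloping (br : V -> V -> V) := quot_alg (lie_relations br).

Definition env_emb (br : V -> V -> V) (X : V) : enveloping br :=
  qa_pi (lie_relations br) (tensor_emb X).

(* Without the usual factor 2: X Y + Y X = b(X, Y). *)
Definition clifford_relations (b : V -> V -> F) : set (tensor_alg V) :=
  [set x | exists X Y : V,
     x = tensor_emb X * tensor_emb Y + tensor_emb Y * tensor_emb X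
         - (b X Y)%:A].

Definition clifford (b : V -> V -> F) := quot_alg (clifford_relations b).

Definition cliff_emb (b : V -> V -> F) (X : V) : clifford b :=
  qa_pi (clifford_relations b) (tensor_emb X).

(* The image of u (x) v under V (x) V -> V^* (x) V -> End V is b(u, _) v, so
   this is the preimage of the identity; it is unique when b is nondegenerate
   and V is finite-dimensional. *)
Definition canonical_tensor (b : V -> V -> F) : tens_mod V V :=
  xget 0 [set w | forall X : V, tens_lift (fun u v => b u X *: v) w = X].

End AlgebrasOfAForm.

Definition cplx (R : realType) : numClosedFieldType := R[i].

Section Groups.
Variables (R : realType) (n : nat).
Local Notation C := (cplx R).
Local Notation M := 'M[C]_n.
Implicit Types (G H : set M) (phi sigma theta : M -> M).

(* The coordinate ring of GL_n, as functions on matrices. *)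
Inductive regular_fun : (M -> C) -> Prop :=
| regular_const (c : C) : regular_fun (fun=> c)
| regular_coord (i j : 'I_n) : regular_fun (fun g => g i j)
| regular_invdet : regular_fun (fun g => (\det g)^-1)
| regular_add f1 f2 : regular_fun f1 -> regular_fun f2 ->
    regular_fun (fun g => f1 g + f2 g)
| regular_mul f1 f2 : regular_fun f1 -> regular_fun f2 ->
    regular_fun (fun g => f1 g * f2 g).

Record is_subgroup G : Prop := {
  subgroup_unit : forall g, G g -> g \in unitmx;
  subgroup_1 : G 1%:M;
  subgroup_mul : forall g h, G g -> G h -> G (g *m h);
  subgroup_inv : forall g, G g -> G (invmx g)
}.

Definition zariski_closed G : Prop :=
  exists S : set (M -> C), S `<=` regular_fun /\
    G = [set g | g \in unitmx /\ forall f, S f -> f g = 0].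

Definition algebraic_group G : Prop := is_subgroup G /\ zariski_closed G.

(* Trivial unipotent radical. *)
Definition reductive G : Prop :=
  algebraic_group G /\
  forall N : set M, algebraic_group N -> connected N -> N `<=` G ->
    (forall g u, G g -> N u -> N (g *m u *m invmx g)) ->
    (forall u, N u -> (u - 1%:M) ^+ n = 0) ->
    N = [set 1%:M].

Record group_involution G phi : Prop := {
  involution_stable : forall g, G g -> G (phi g);
  involution_mul : forall g h, G g -> G h -> phi (g *m h) = phi g *m phi h;
  involutionK : forall g, G g -> phi (phi g) = g
}.

(* Near every point of G, the conjugate of each matrix entry of phi extends to
   a holomorphic function on an open set of matrices. *)
Definition antiholomorphic_on G phi : Prop :=
  forall g, G g -> forall i j, exists h : M -> C,
    (\forall x \near g, differentiable h x) /\
    (\forall x \near g, G x -> phi x i j = (h x)^*).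

Definition algebraic_on G phi : Prop :=
  forall i j, exists2 f, regular_fun f & forall g, G g -> phi g i j = f g.

Definition fixed G phi : set M := [set g | G g /\ phi g = g].

Definition maximal_compact_subgroup G H : Prop :=
  [/\ is_subgroup H, compact H, H `<=` G &
      forall L, is_subgroup L -> compact L -> L `<=` G -> H `<=` L -> L = H].

(* theta is a Cartan involution for sigma: an algebraic involution commuting
   with sigma such that sigma \o theta defines a compact real form. *)
Record cartan_involution G sigma theta : Prop := {
  cartan_group : group_involution G theta;
  cartan_algebraic : algebraic_on G theta;
  cartan_comm : forall g, G g -> sigma (theta g) = theta (sigma g);
  cartan_compact : compact (fixed G (sigma \o theta));
  cartan_maximal :
    maximal_compact_subgroup (fixed G sigma) (fixed (fixed G theta) sigma)
}.

Definition curve_in G (c : R -> M) (X : M) : Prop :=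
  [/\ forall t, G (c t), c 0 = 1%:M &
      (t%:C%C : C)^-1 *: (c t - 1%:M) @[t --> 0^'] --> X].

(* The tangent space at 1, as the velocities at 0 of curves in G. *)
Definition is_lie_algebra_of G (g : {vspace M}) : Prop :=
  forall X, X \in g <-> exists c, curve_in G c X.

Definition is_differential G phi (dphi : M -> M) : Prop :=
  forall c X, curve_in G c X -> curve_in G (phi \o c) (dphi X).

Definition lie (X Y : M) : M := X *m Y - Y *m X.

Definition derived_algebra (g : {vspace M}) : {vspace M} :=
  <<[seq lie X Y | X <- vbasis g, Y <- vbasis g]>>%VS.

(* tr (ad X \o ad Y) on h *)
Definition killing (h : {vspace M}) (X Y : M) : C :=
  \sum_(i < \dim h) coord (vbasis h) i (lie X (lie Y (vbasis h)`_i)).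

Definition minus_eigenspace (g : {vspace M}) (dtheta : 'End(M)) : {vspace M} :=
  (g :&: lker (dtheta + \1%VF)%R)%VS.

Record adapted_form (K : set M) (g k p : {vspace M}) (dsigma : M -> M)
    (dtheta : 'End(M)) (beta : {bilinear M -> M -> C}) : Prop := {
  form_sym : {in g &, forall X Y, beta X Y = beta Y X};
  form_killing : {in derived_algebra g &, forall X Y,
    beta X Y = killing (derived_algebra g) X Y};
  form_pos : forall X, X \in p -> dsigma X = X -> X != 0 -> 0 < beta X X;
  form_neg : forall X, X \in k -> dsigma X = X -> X != 0 -> beta X X < 0;
  form_theta : {in g &, forall X Y, beta (dtheta X) (dtheta Y) = beta X Y};
  form_K : forall h, K h -> {in g &, forall X Y,
    beta (h *m X *m invmx h) (h *m Y *m invmx h) = beta X Y};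
  form_ad : {in g & &, forall Z X Y, beta (lie Z X) Y = - beta X (lie Z Y)}
}.

Section MotionGroup.
Variables (k p : {vspace M}) (beta : {bilinear M -> M -> C}).

(* The pair (Y, X) stands for X + Y.  As [k, k] <= k and [k, p] <= p for a
   Cartan decomposition, the projections vsproj act as the identity here. *)
Definition motion_algebra : lmodType C := (subvs_of k * subvs_of p)%type.

Definition motion_bracket (Z1 Z2 : motion_algebra) : motion_algebra :=
  (vsproj k (lie (vsval Z1.1) (vsval Z2.1)),
   vsproj p (lie (vsval Z1.1) (vsval Z2.2) + lie (vsval Z1.2) (vsval Z2.1))).

Definition form0 (X Y : subvs_of p) : C := beta (vsval X) (vsval Y).

Definition Ug0 := enveloping motion_bracket.
Definition iota0 (X : subvs_of p) : Ug0 := env_emb motion_bracket (0, X).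

Definition Cl0 := clifford form0.

Definition A0 := tens_prod (lie_relations motion_bracket)
                           (clifford_relations form0).

Definition Casimir0 : Ug0 :=
  tens_lift (fun X Y => iota0 X * iota0 Y) (canonical_tensor form0).

Definition Dirac0 : A0 :=
  tens_lift (fun X Y => pure_tens (iota0 X) (cliff_emb form0 Y) : A0)
    (canonical_tensor form0).

End MotionGroup.
End Groups.

(* Main.v *)
(* Write the canonical tensor as a finite sum of u_i (x) v_i, so that
   D = sum_i u_i (x) gamma(v_i).  Since p_0 is abelian, the U(g_0)-factors
   commute, and symmetrizing D^2 leaves
   2 D^2 = sum_(i, j) u_i u_j (x) (gamma(v_i) gamma(v_j) + gamma(v_j) gamma(v_i))
         = sum_(i, j) beta(v_i, v_j) u_i u_j (x) 1,
   which is sum_i u_i v_i (x) 1 because sum_j beta(v_j, X) u_j = X.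
   Nondegeneracy of beta is not established separately: if it failed, no tensor
   would represent the identity, and canonical_tensor would take its default
   value 0, making both sides zero. *)

Require Import Defs.
From HB Require Import structures.
From mathcomp Require Import all_boot all_order all_algebra.
From mathcomp Require Import finmap.
From mathcomp Require Import complex monalg.
From mathcomp Require Import all_classical all_reals all_analysis.
Import Order.TTheory GRing.Theory Num.Theory.
Import numFieldNormedType.Exports.
Local Open Scope classical_set_scope.
Local Open Scope ring_scope.

(** Such sums form a submodule, a scalar being absorbed into the left factors; hence the finite
    families u_i, v_i. *)
Lemma tens_sum {F : fieldType} {V W : lmodType F} (w : tens_mod V W) :
  exists s : seq (V * W), w = \sum_(x <- s) tens x.1 x.2.
Proof.
apply: (tens_ind (P := [set w | exists s, w = \sum_(x <- s) tens x.1 x.2]));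
  last by move=> v u; exists [:: (v, u)]; rewrite big_seq1.
split=> [|a x y [s ->] [t ->]]; first by exists [::]; rewrite big_nil.
exists ([seq (a *: z.1, z.2) | z <- s] ++ t).
rewrite big_cat big_map scaler_sumr; congr (_ + _).
apply: eq_bigr => z _ /=.
have tl : linear (@tens F V W ^~ z.2) by apply: (@tens_bilinear F V W).1.
by have := tl a z.1 0; rewrite /= (linear_map0 tl) !addr0 => ->.
Qed.

Lemma linear_sum_comb {F : fieldType} {V W : lmodType F} {f : V -> W} {I : Type}
    {s : seq I} {a : I -> F} {v : I -> V} :
  linear f -> f (\sum_(i <- s) a i *: v i) = \sum_(i <- s) a i *: f (v i).
Proof.
move=> f_lin; elim: s => [|i s IHs]; first by rewrite !big_nil linear_map0.
by rewrite !big_cons f_lin IHs.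
Qed.

Lemma tens_lift_sum {F : fieldType} {V W M : lmodType F} {f : V -> W -> M}
    (s : seq (V * W)) :
  is_bilinear f ->
  tens_lift f (\sum_(x <- s) tens x.1 x.2) = \sum_(x <- s) f x.1 x.2.
Proof.
move=> fB; elim: s => [|x s IHs].
  by rewrite !big_nil; apply: linear_map0; apply: tens_lift_linear.
have := tens_lift_linear fB 1 (tens x.1 x.2) (\sum_(y <- s) tens y.1 y.2).
by rewrite !big_cons !scale1r tens_liftE // IHs.
Qed.

Lemma canonical_tensorP {F : fieldType} {V : lmodType F} (b : V -> V -> F) :
  canonical_tensor b = 0 \/
  forall X, tens_lift (fun u v => b u X *: v) (canonical_tensor b) = X.
Proof.
by rewrite /canonical_tensor; case: xgetP => [w _ hw|_]; [right|left].
Qed.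

(* A left inverse X |-> \sum_i b(u_i, X) v_i of a symmetric form makes it
   nondegenerate, so pairing both sides with Y lets u and v be exchanged. *)
Lemma dual_family_swap {F : fieldType} {V : lmodType F} {b : V -> V -> F}
    {s : seq (V * V)} :
  (forall X, linear (b X : V -> F^o)) -> (forall X Y, b X Y = b Y X) ->
  (forall X, \sum_(x <- s) b x.1 X *: x.2 = X) ->
  forall X, \sum_(x <- s) b x.2 X *: x.1 = X.
Proof.
move=> b_lin b_sym sK X; set Z := LHS.
have bZ Y : b Y Z = b Y X.
  rewrite (linear_sum_comb (b_lin Y)) -[in RHS](sK Y) b_sym.
  rewrite (linear_sum_comb (b_lin X)).
  by apply: eq_bigr => x _; rewrite /= (b_sym Y) (b_sym X) [LHS]mulrC.
by rewrite -[LHS]sK -[RHS]sK; apply: eq_bigr => x _; rewrite bZ.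
Qed.

Lemma pure_tensM {F : fieldType} {A B : algType F} {S : set A} {T : set B}
    (a c : quot_alg S) (b d : quot_alg T) :
  pure_tens a b * pure_tens c d = pure_tens (a * c) (b * d).
Proof. exact: tens_mulE. Qed.

Section AbstractDirac.
Context {F : fieldType} {V : lmodType F} {A B : algType F}.
Context {S : set A} {T : set B}.
Variables (b : V -> V -> F) (f : V -> quot_alg S) (g : V -> quot_alg T).
Hypotheses (b_lin : forall X, linear (b X : V -> F^o))
  (b_sym : forall X Y, b X Y = b Y X).
Hypotheses (f_lin : linear f) (g_lin : linear g).
Hypothesis f_comm : forall X Y, f X * f Y = f Y * f X.
Hypothesis g_cliff : forall X Y, g X * g Y + g Y * g X = b X Y *: (1 : quot_alg T).

Let D : tens_prod S T :=
  tens_lift (fun X Y => pure_tens (f X) (g Y) : tens_prod S T)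
    (canonical_tensor b).

(** The computation with the algebras abstracted: [f] stands for the embedding of p_0 in U(g_0),
    with commuting values, and [g] for the Clifford embedding. *)
Lemma dirac_square :
  D ^+ 2 *+ 2 =
    pure_tens (tens_lift (fun X Y => f X * f Y) (canonical_tensor b)) 1.
Proof.
have DB : is_bilinear (fun X Y => pure_tens (f X) (g Y) : tens_prod S T).
  split=> [Y a X X'|X a Y Y'] /=.
    by rewrite f_lin pure_tensDl pure_tensZl.
  by rewrite g_lin pure_tensDr pure_tensZr.
have OB : is_bilinear (fun X Y => f X * f Y).
  split=> [Y a X X'|X a Y Y'] /=.
    by rewrite f_lin mulrDl -qa_scalerAl.
  by rewrite f_lin mulrDr -qa_scalerAr.
have bB X : is_bilinear (fun u v : V => b u X *: v).
  split=> [v a u u'|u a v v'] /=.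
    by rewrite ![b _ X]b_sym b_lin scalerDl scalerA.
  by rewrite scalerDr !scalerA mulrC.
have pure0l (Y : quot_alg T) : pure_tens (0 : quot_alg S) Y = 0.
  by rewrite -(scale0r (0 : quot_alg S)) pure_tensZl scale0r.
have [w0|] := canonical_tensorP b.
  rewrite /D w0 (linear_map0 (tens_lift_linear DB)).
  by rewrite (linear_map0 (tens_lift_linear OB)) pure0l expr0n mul0rn.
rewrite /D; have [s ->] := tens_sum (canonical_tensor b) => sK.
(* From here on [sK] expands X in the u_i with coefficients b(v_i, X), instead of in the v_i. *)
have {}sK := dual_family_swap b_lin b_sym
  (fun X => etrans (esym (tens_lift_sum s (bB X))) (sK X)).
rewrite (tens_lift_sum s DB) (tens_lift_sum s OB) expr2 mulr2n.
(* Exchanging the indices in one of the two copies of D^2 pairs the (i, j) term with the (j, i)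
   term. *)
rewrite big_distrlr /= [X in _ + X]exchange_big -big_split /=.
rewrite (big_morph (fun x => pure_tens x 1) (fun x y => pure_tensDl x y 1) (pure0l 1)).
apply: eq_bigr => x _; rewrite -big_split /=.
(* Expanding v_i as sum_j b(v_j, v_i) u_j makes the right side a sum over j too, to be matched term
   by term. *)
rewrite -[in RHS](sK x.2) (linear_sum_comb f_lin) mulr_sumr.
rewrite (big_morph (fun x => pure_tens x 1) (fun x y => pure_tensDl x y 1) (pure0l 1)).
apply: eq_bigr => y _.
(* Commutation gives both terms the left factor f(u_i) f(u_j), leaving a Clifford anticommutator on
   the right. *)
rewrite !pure_tensM [f y.1 * _]f_comm -pure_tensDr g_cliff.
by rewrite pure_tensZr -pure_tensZl qa_scalerAr b_sym.
Qed.

End AbstractDirac.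

(** A relation s lies in the ideal as 1 s 1. The defining relations of the tensor, enveloping and
    Clifford algebras are all obtained this way. *)
Lemma qa_pi_eq {F : fieldType} {A : algType F} {S : set A} {x y : A} :
  S (x - y) -> qa_pi S x = qa_pi S y.
Proof.
move=> Sxy; apply/qm_piP => W _; apply.
by exists 1, (x - y), 1; rewrite mul1r mulr1.
Qed.

Lemma tensor_emb_linear {F : fieldType} {V : lmodType F} :
  linear (@tensor_emb F V).
Proof.
move=> a u v; rewrite /tensor_emb -lock.
transitivity (qa_pi (@linear_relations F V) (a *: free_gen u + free_gen v)).
  by apply: qa_pi_eq; exists a, u, v.
exact: linearP.
Qed.

Lemma env_emb_linear {F : fieldType} {V : lmodType F} (br : V -> V -> V) :
  linear (env_emb br).
Proof. by move=> a u v; rewrite /env_emb tensor_emb_linear linearP. Qed.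

Lemma cliff_emb_linear {F : fieldType} {V : lmodType F} (b : V -> V -> F) :
  linear (cliff_emb b).
Proof. by move=> a u v; rewrite /cliff_emb tensor_emb_linear linearP. Qed.

Lemma env_emb_commutator {F : fieldType} {V : lmodType F} (br : V -> V -> V) X Y :
  env_emb br X * env_emb br Y - env_emb br Y * env_emb br X = env_emb br (br X Y).
Proof.
by rewrite /env_emb -!qa_piM -raddfB; apply: qa_pi_eq; exists X, Y.
Qed.

Lemma cliff_emb_anticommutator {F : fieldType} {V : lmodType F}
    (b : V -> V -> F) X Y :
  cliff_emb b X * cliff_emb b Y + cliff_emb b Y * cliff_emb b X =
    b X Y *: (1 : clifford b).
Proof.
rewrite /cliff_emb -!qa_piM -raddfD -qa_pi1 -qa_piZ.
by apply: qa_pi_eq; exists X, Y.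
Qed.

Section MotionGroup.
Context {R : realType} {n : nat} (k p : {vspace 'M[cplx R]_n}).

Lemma iota0_linear : linear (iota0 k (p := p)).
Proof.
move=> a X Y; rewrite /iota0 -env_emb_linear; congr env_emb.
by congr pair; rewrite /= scaler0 addr0.
Qed.

(** Every term of [motion_bracket] involves a k-component, so the bracket vanishes on p_0, and with
    it the commutator in U(g_0). *)
Lemma iota0_comm X Y : iota0 k (p := p) X * iota0 k Y = iota0 k Y * iota0 k X.
Proof.
have p0_abelian : motion_bracket (k := k) (0, X) (0, Y) = 0.
  rewrite /motion_bracket /lie /= !linear0 !mul0mx !subrr addr0.
  by rewrite addr0 !linear0.
apply/eqP; rewrite -subr_eq0 env_emb_commutator p0_abelian.
by apply/eqP; exact: (linear_map0 (env_emb_linear _)).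
Qed.

End MotionGroup.

Theorem lemma2p4p4 (R : realType) (n : nat)
    (G : set 'M[cplx R]_n) (sigma theta : 'M[cplx R]_n -> 'M[cplx R]_n)
    (g k : {vspace 'M[cplx R]_n})
    (dsigma : {linear 'M[cplx R]_n -> 'M[cplx R]_n | Num.conj \; *:%R})
    (dtheta : 'End('M[cplx R]_n))
    (beta : {bilinear 'M[cplx R]_n -> 'M[cplx R]_n -> cplx R}) :
  let K := fixed G theta in
  let p := minus_eigenspace g dtheta in
  reductive G -> connected G ->
  group_involution G sigma -> antiholomorphic_on G sigma ->
  connected (fixed G sigma) -> ~ compact (fixed G sigma) ->
  cartan_involution G sigma theta ->
  is_lie_algebra_of G g -> is_lie_algebra_of K k ->
  is_differential G sigma dsigma -> is_differential G theta dtheta ->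
  adapted_form K g k p dsigma dtheta beta ->
  (Dirac0 k p beta) ^+ 2 *+ 2 =
    pure_tens (Casimir0 k p beta) (1 : Cl0 p beta) :> A0 k p beta.
Proof.
move=> K p _ _ _ _ _ _ _ _ _ _ _ beta_adapted.
apply: dirac_square.
- by move=> X a Y Z; rewrite /form0 [vsval (_ + _)]linearP; exact: (linearPr beta).
(* Symmetry is given on g only; p lies in g, being an intersection with it. *)
- move=> X Y; apply: (form_sym beta_adapted);
    by apply: (subvP (capvSl _ _)); apply: subvsP.
- exact: iota0_linear.
- exact: cliff_emb_linear.
- exact: iota0_comm.
- exact: cliff_emb_anticommutator.
Qed.
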